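(* Let $d\ge 2$ and let $p=(p_1,\dots,p_d)$ be a probability vector with $p_j\neq1$ for all $j$. Let $l_n$, $n\ge 0$, be the SICTA collision resolution interval lengths with splitting probabilities $p$, let $Q(x,z)=e^{-x}\sum_{n\ge 0}\frac{x^n}{n!}\mathbb{E}[z^{l_n}]$, and write $$Q(x,z)=\sum_{j\ge 0}z^j q_j(x),\qquad q_j(x)=\sum_{n=0}^\infty \mathbb{P}(l_n=j)\,e^{-x}\frac{x^n}{n!}.$$ Then $q_0(x)=0$, and for every $j\ge 1$ the function $q_j$ is given in terms of $q_0,\dots,q_{j-1}$ by the recursive equation $$q_j(x)=Q(d,x,j)+\sum_{k=0}^{d-2} f_k(x)\Big(Q(k,x,j-1)\mathbf{1}\{j\ge 1\}-Q(k,x,j-2)\mathbf{1}\{j\ge 2\}\Big),$$ where $\overline{F}(k)=\sum_{i=k+1}^d p_i$, $f_k(x)=(1+\overline{F}(k)x)e^{-\overline{F}(k)x}$, and $$Q(k,x,j)=\sum_{\substack{\mu\in\mathbb{N}_0^k\\ \mu_1+\dots+\mu_k=j}}\ \prod_{i=1}^k q_{\mu_i}(xp_i)$$ (with $Q(0,x,0)=1$ and $Q(0,x,j)=0$ for $j\ge1$); the right-hand side of the recursion depends only on $q_0,\dots,q_{j-1}$.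
   Context: Definition of $l_n$. For $n\ge 2$ let $(I_1,\dots,I_d)$ be multinomially distributed with $n$ trials and cell probabilities $p=(p_1,\dots,p_d)$, and let $$M=\inf\Big\{k\in\{1,\dots,d\}:\ \sum_{j=1}^k I_j\ge n-1\Big\}.$$ The laws of the (almost surely finite, positive integer valued) random variables $l_n$ are determined recursively by $l_0=l_1=1$ and, for $n\ge 2$, by the distributional identity $$l_n=\mathbf{1}\{M<d\}+\sum_{j=1}^{M} l_{I_j},$$ where, given $(I_1,\dots,I_d)$, the variables $l_{I_1},\dots,l_{I_d}$ on the right are independent, $l_{I_j}$ having the law of $l_m$ with $m=I_j$. One may take $x\ge 0$ real (or $x\in\mathbb{C}$) and $|z|\le1$, so that all series converge. *)

(* Defs.v *)
(* MathComp-Analysis; complex numbers from mathcomp-real-closed *)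
From mathcomp Require Import all_boot all_order all_algebra.
From mathcomp Require Import all_classical all_reals all_analysis.
From mathcomp Require Export complex.

Set Implicit Arguments.
Unset Strict Implicit.
Unset Printing Implicit Defensive.

Import Order.TTheory GRing.Theory Num.Theory.
Import numFieldNormedType.Exports.

Local Open Scope classical_set_scope.
Local Open Scope ring_scope.
Local Open Scope complex_scope.

(* Indices are shifted by one: the mathematical p_{i+1} is the entry p`_i, and
   the mathematical I_{i+1} is the component of index i : 'I_d. *)

Definition multinomial_pmf (R : realType) (d : nat) (p : d.-tuple R) (n : nat)
    (i : 'I_d -> nat) : R :=
  if (\sum_(j < d) i j == n)%N then
    n`!%:R / (\prod_(j < d) (i j)`!)%N%:R * \prod_(j < d) p`_j ^+ i j
  else 0.

(* inf {k in {1, ..., d} : i_1 + ... + i_k >= n - 1}; the default value d of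
   the iterated minimum is immaterial, as k = d qualifies when the i_j sum
   to n. *)
Definition stop_index (d n : nat) (i : 'I_d -> nat) : nat :=
  \big[minn/d]_(1 <= k < d.+1 | (n.-1 <= \sum_(j < d | (j < k)%N) i j)%N) k.

Definition sicta_rhs (d n : nat) (i a : 'I_d -> nat) : nat :=
  let M := stop_index n i in ((M < d)%N + \sum_(j < d | (j < M)%N) a j)%N.

(* The distributional recursion constrains only the marginal laws of the l_n:
   for each n >= 2 its right-hand side lives on an auxiliary probability space
   (T', P'), which carries the multinomial vector I and variables L_j that,
   given I = i, are independent with L_j distributed as l_(i_j). *)
Definition is_sicta (R : realType) (d : nat) (p : d.-tuple R)
    (dT : measure_display) (T : measurableType dT) (P : probability T R)
    (l : nat -> {RV P >-> nat}) : Prop :=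
  [/\ P (l 0%N @^-1` [set 1%N]) = 1%E,
      P (l 1%N @^-1` [set 1%N]) = 1%E &
      forall n : nat, (2 <= n)%N ->
      exists (dT' : measure_display) (T' : measurableType dT')
        (P' : probability T' R) (I L : 'I_d -> {RV P' >-> nat}),
      [/\ forall i : 'I_d -> nat,
            P' [set w | forall j, I j w = i j] = (multinomial_pmf p n i)%:E,
          forall i a : 'I_d -> nat,
            P' [set w | forall j, I j w = i j /\ L j w = a j] =
            (P' [set w | forall j, I j w = i j] *
             \prod_(j < d) P (l (i j) @^-1` [set a j]))%E
        & forall A : set nat,
            distribution P (l n) A =
            pushforward P' (fun w => sicta_rhs n (I ^~ w) (L ^~ w)) A]].

Definition complex_expectation (R : realType) (dT : measure_display)
    (T : measurableType dT) (P : probability T R) (X : T -> R[i]) : R[i] :=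
  fine ('E_P[fun w => complex.Re (X w)])%E +i*
  fine ('E_P[fun w => complex.Im (X w)])%E.

(* R[i]^o is R[i] with the normed structure given by its modulus. *)
Definition sicta_Q (R : realType) (dT : measure_display)
    (T : measurableType dT) (P : probability T R) (l : nat -> {RV P >-> nat})
    (x : R) (z : R[i]) : R[i]^o :=
  (expR (- x))%:C *
  limn (series ((fun n : nat => (x ^+ n / n`!%:R)%:C *
    complex_expectation P (fun w => z ^+ l n w)) : nat -> R[i]^o)).

Definition sicta_q (R : realType) (dT : measure_display)
    (T : measurableType dT) (P : probability T R) (l : nat -> {RV P >-> nat})
    (j : nat) (x : R) : R :=
  limn (series (fun n : nat =>
    fine (P (l n @^-1` [set j])) * (expR (- x) * (x ^+ n / n`!%:R)))).

Definition Fbar (R : realType) (d : nat) (p : d.-tuple R) (k : nat) : R :=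
  \sum_(k <= i < d) p`_i.

Definition f_ (R : realType) (d : nat) (p : d.-tuple R) (k : nat) (x : R) : R :=
  (1 + Fbar p k * x) * expR (- (Fbar p k * x)).

(* Q(k, x, j) for an arbitrary family g in place of (q_j).  The entries of mu
   are at most j since they sum to j. *)
Definition Qconv (R : realType) (d : nat) (p : d.-tuple R)
    (g : nat -> R -> R) (k : nat) (x : R) (j : nat) : R :=
  \sum_(mu : {ffun 'I_k -> 'I_j.+1} | (\sum_(i < k) mu i == j)%N)
    \prod_(i < k) g (mu i) (x * p`_i).

Definition recursion_rhs (R : realType) (d : nat) (p : d.-tuple R)
    (g : nat -> R -> R) (j : nat) (x : R) : R :=
  Qconv p g d x j +
  \sum_(k < d.-1) f_ p k x *
    (Qconv p g k x (j - 1) * (1 <= j)%N%:R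
     - Qconv p g k x (j - 2) * (2 <= j)%N%:R).

(* Main.v *)
Require Import Defs.
From mathcomp Require Import all_boot all_order all_algebra.
From mathcomp Require Import all_classical all_reals all_analysis.
From mathcomp Require Import zify ring lra.

Set Implicit Arguments.
Unset Strict Implicit.
Unset Printing Implicit Defensive.

Import Order.TTheory GRing.Theory Num.Theory.
Import numFieldNormedType.Exports.

Local Open Scope classical_set_scope.
Local Open Scope ring_scope.
Local Open Scope complex_scope.

(** The recursion is a decomposition of the event [l_n = j] followed by
    Poissonization.

    Fix n >= 2 and an outcome (i, a) of the splitting, i the counts and a the
    lengths of the sub-intervals, and write S_k(a) for the sum of the first k
    lengths and T_k(i) for the number of packets in the cells from k on.  As
    the counts sum to n, the stopping index M satisfies M <= k iff
    T_k(i) <= 1 ([stop_index_le]).  A cell with at most one packet has length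
    1, so S_(k+1) = S_k + 1 for M <= k < d, and the indicator of
    1{M < d} + S_M = j telescopes into
      1{S_d = j} + sum_(k < d-1) 1{T_k <= 1} (1{S_k + 1 = j} - 1{S_k + 2 = j})
    ([sicta_rhs_expansion]).  The same formula, with M = 0, gives 1{1 = j} when
    n <= 1 ([small_expansion]), so that no case distinction on n remains.

    If n is Poisson of mean x, then the counts are independent Poisson of means
    x p_m ([poisson_weight_multinomial]) and cell m contributes q_(a_m)(x p_m).
    The term 1{S_d = j} therefore yields the full convolution Q(d, x, j); in
    the k-th term the event T_k <= 1 is independent of the first k cells, has
    probability f_k(x) ([prod_poisson_weight_le1]), and forces the remaining
    lengths to be 1, which leaves Q(k, x, j-1) - Q(k, x, j-2).

    Rigorously, only finitely many outcomes (i, a) with value j have positive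
    probability, because every a_m is then at most j + 1 ([law_step]).  The
    N-th partial sum of q_j(x) thus is a finite sum over counts with total less
    than N, and its limit comes from squeezing this simplex between two boxes,
    over which sums of products factor ([cvg_simplex_sum]).

    That q_0 vanishes, and with it every term of Q(d, x, j) that involves q_j,
    holds since P(l_n = 0) = 0, by induction on n ([law_at0]).  The
    generating function identity is an exchange of limits, justified by
    dominated convergence for series ([tannery]). *)

(** * The stopping index *)

Definition head_sum (d k : nat) (a : 'I_d -> nat) : nat :=
  (\sum_(m < d | (m < k)%N) a m)%N.

Definition tail_sum (d k : nat) (a : 'I_d -> nat) : nat :=
  (\sum_(m < d | (k <= m)%N) a m)%N.

Lemma head_tail_sum (d k : nat) (a : 'I_d -> nat) :
  (head_sum k a + tail_sum k a = \sum_(m < d) a m)%N.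
Proof.
rewrite /head_sum /tail_sum [RHS](bigID (fun m : 'I_d => (m < k)%N)) /=.
by congr addn; apply: eq_bigl => m; rewrite -leqNgt.
Qed.

Lemma leq_head_sum (d k k' : nat) (a : 'I_d -> nat) :
  (k <= k')%N -> (head_sum k a <= head_sum k' a)%N.
Proof.
move=> kk'; rewrite /head_sum [leqRHS](bigID (fun m : 'I_d => (m < k)%N)) /=.
have -> : (\sum_(m < d | (m < k)%N) a m =
    \sum_(m < d | (m < k')%N && (m < k)%N) a m)%N.
  by apply: eq_bigl => m; lia.
exact: leq_addr.
Qed.

Lemma head_sum0 (d : nat) (a : 'I_d -> nat) : head_sum 0 a = 0%N.
Proof. by rewrite /head_sum big_pred0. Qed.

Lemma head_sum_full (d : nat) (a : 'I_d -> nat) :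
  head_sum d a = (\sum_(m < d) a m)%N.
Proof. by apply: eq_bigl => m; rewrite ltn_ord. Qed.

Lemma head_sumS (d k : nat) (a : 'I_d -> nat) (kd : (k < d)%N) :
  head_sum k.+1 a = (head_sum k a + a (Ordinal kd))%N.
Proof.
rewrite /head_sum (bigD1 (Ordinal kd)) //= addnC; congr addn.
by apply: eq_bigl => m; rewrite -val_eqE /=; lia.
Qed.

Lemma leq_tail_sum (d k : nat) (a : 'I_d -> nat) (m : 'I_d) :
  (k <= m)%N -> (a m <= tail_sum k a)%N.
Proof. by move=> km; rewrite /tail_sum (bigD1 m) //= leq_addr. Qed.

(** The counts before cell k sum to at least n - 1 exactly when at most one
    packet is left for the cells from k on.  For k = 0 both sides are false,
    as n >= 2. *)
Lemma stop_index_le (d n : nat) (i : 'I_d -> nat) (k : nat) :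
  (2 <= n)%N -> (\sum_(m < d) i m = n)%N -> (k <= d)%N ->
  (stop_index n i <= k)%N = (tail_sum k i <= 1)%N.
Proof.
move=> n2 sum_i kd.
have d_gt0 : (0 < d)%N.
  by case: d i sum_i {kd} => // i; rewrite big_ord0; lia.
have headE q : head_sum q i = (n - tail_sum q i)%N.
  by rewrite -sum_i -(head_tail_sum q i) addnK.
have tail_le q : (tail_sum q i <= n)%N.
  by rewrite -sum_i -(head_tail_sum q i) leq_addl.
apply/idP/idP.
- move=> stop_le.
  suff /and3P[_ _ P_stop] : [&& 0 < stop_index n i, stop_index n i <= d
      & n.-1 <= head_sum (stop_index n i) i]%N.
    have := leq_trans P_stop (leq_head_sum i stop_le).
    by have := tail_le k; rewrite headE; lia.
  (* The default value d of the minimum also satisfies the invariant. *)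
  rewrite /stop_index big_seq_cond.
  apply: (big_ind (fun v => [&& 0 < v, v <= d & n.-1 <= head_sum v i]%N)).
  + by rewrite d_gt0 leqnn head_sum_full sum_i leq_pred.
  + by move=> u v Ku Kv; case: (leqP u v).
  + move=> v /andP[]; rewrite mem_index_iota => /andP[v0 vd] Pv.
    by rewrite v0 -ltnS vd.
- move=> tail1.
  have k_gt0 : (0 < k)%N.
    case: k {kd} tail1 => //; have := head_tail_sum 0 i.
    by rewrite head_sum0 sum_i; lia.
  have Pk : (n.-1 <= head_sum k i)%N by rewrite headE; lia.
  have : k \in index_iota 1 d.+1 by rewrite mem_index_iota; lia.
  rewrite /stop_index; elim: (index_iota _ _) => // v r IH.
  rewrite in_cons big_cons => /predU1P[<-|/IH le_k].
    by rewrite /head_sum in Pk; rewrite Pk geq_minl.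
  case: ifP => // _; exact: leq_trans (geq_minr _ _) le_k.
Qed.

(** With phi k the indicator of S k + 1 = j, the summand for k >= M is
    phi k - phi (k + 1), so the sum telescopes to phi M - phi (d - 1), where
    phi M is the left-hand side and phi (d - 1) the indicator of S d = j.  For
    M = d all summands vanish. *)
Lemma telescope_stop (R : realType) (d M j : nat) (S : nat -> nat) :
  (0 < d)%N -> (M <= d)%N ->
  (forall k, (M <= k < d)%N -> S k.+1 = (S k).+1) ->
  (((M < d) + S M == j)%N%:R : R) =
  (S d == j)%N%:R +
  \sum_(k < d.-1) (M <= k)%N%:R * (((S k).+1 == j)%N%:R - ((S k).+2 == j)%N%:R).
Proof.
move=> d0 Md HS.
have [Md'|dM] := ltnP M d; last first.
  have -> : M = d by lia.
  rewrite add0n big1 ?addr0 // => k _.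
  by rewrite leqNgt (leq_trans (ltn_ord k)) ?leq_pred // mul0r.
have telescope : \sum_(k < d.-1)
    (M <= k)%N%:R * (((S k).+1 == j)%N%:R - ((S k).+2 == j)%N%:R) =
    ((S M).+1 == j)%N%:R - (S d == j)%N%:R :> R.
  rewrite -(big_mkord xpredT (fun k => (M <= k)%N%:R *
    (((S k).+1 == j)%N%:R - ((S k).+2 == j)%N%:R) : R)).
  rewrite (big_cat_nat (n := M)) //=; last by lia.
  rewrite big_nat_cond big1 ?add0r; last first.
    by move=> k /andP[/andP[_ kM] _]; rewrite leqNgt kM mul0r.
  rewrite (telescope_sumr_eq (fun k => - ((S k).+1 == j)%N%:R)).
  - by rewrite -HS ?prednK //; [rewrite opprK addrC|lia].
  - by lia.
  - by move=> k /andP[Mk kd]; rewrite Mk mul1r (HS k) ?opprK 1?addrC //; lia.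
by rewrite telescope addrC subrK add1n.
Qed.

Lemma prod_natr_forall (R : realType) (I : finType) (A b : pred I) :
  \prod_(m | A m) (b m)%:R = [forall m, A m ==> b m]%:R :> R.
Proof.
case: forallP => [Hb|/forallP]; first last.
  rewrite negb_forall => /existsP[m]; rewrite negb_imply => /andP[Am bm].
  by rewrite (bigD1 m) //= (negbTE bm) mul0r.
by rewrite big1 // => m Am; have := Hb m; rewrite Am => /= ->.
Qed.

(** Splits the event that the sum is at most 1 into the zero family and the
    indicators of singletons; each piece is a product over the coordinates,
    which is what makes the event compatible with product weights. *)
Lemma sum_le1_natr (R : realType) (I : finType) (A : pred I) (i : I -> nat) :
  (\sum_(m | A m) i m <= 1)%N%:R =
  \prod_(m | A m) (i m == 0)%N%:R +
  \sum_(t | A t) \prod_(m | A m) (i m == (m == t))%N%:R :> R.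
Proof.
rewrite prod_natr_forall.
under [X in _ + X]eq_bigr do rewrite prod_natr_forall.
case: forallP => [i0|/forallP]; first last.
  rewrite negb_forall => /existsP[t0]; rewrite negb_imply => /andP[At0 it0].
  rewrite add0r [RHS](bigD1 t0) //= [X in _ = _ + X]big1 ?addr0; last first.
    move=> t /andP[At tt0]; case: forallP => // /(_ t0).
    by rewrite At0 (eq_sym t0) (negbTE tt0) (negbTE it0).
  congr (nat_of_bool _)%:R; apply/idP/forallP => [sum1 m|im].
  - apply/implyP => Am; have [->|mt0] := eqVneq m t0.
      by move: sum1; rewrite (bigD1 t0) //=; lia.
    move: sum1; rewrite (bigD1 t0) //= (bigD1 m) /=; last by rewrite Am.
    by lia.
  - rewrite (bigD1 t0) //= big1 ?addn0.
      by have := im t0; rewrite At0 eqxx /= => /eqP ->.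
    by move=> m /andP[Am mt0]; have := im m; rewrite Am (negbTE mt0) => /eqP.
rewrite big1 => [|m Am]; last by have := i0 m; rewrite Am => /eqP.
rewrite big1 ?addr0 // => t At; case: forallP => // /(_ t).
by have := i0 t; rewrite At eqxx => /eqP ->.
Qed.

(** The indicator of [sicta_rhs n i a = j] in telescoped form: it mentions the
    stopping index only through the events [tail_sum k i <= 1]. *)
Definition stop_expansion (R : realType) (d j : nat) (i a : 'I_d -> nat) : R :=
  (head_sum d a == j)%N%:R +
  \sum_(k < d.-1) (tail_sum k i <= 1)%N%:R *
    (((head_sum k a).+1 == j)%N%:R - ((head_sum k a).+2 == j)%N%:R).

Lemma stop_expansionE (R : realType) (d j M : nat) (i a : 'I_d -> nat) :
  (0 < d)%N -> (M <= d)%N ->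
  (forall k, (k < d)%N -> (M <= k)%N = (tail_sum k i <= 1)%N) ->
  (forall m, (i m <= 1)%N -> a m = 1%N) ->
  stop_expansion R j i a = ((M < d) + head_sum M a == j)%N%:R.
Proof.
move=> d0 Md HM ia.
rewrite (telescope_stop R j d0 Md (S := fun k => head_sum k a)).
  congr (_ + _); apply: eq_bigr => k _; rewrite HM //.
  by rewrite (leq_trans (ltn_ord k)) // leq_pred.
move=> k /andP[Mk kd]; rewrite (head_sumS a kd) ia ?addn1 //.
by apply: leq_trans (leq_tail_sum i (leqnn _)) _ => /=; rewrite -HM.
Qed.

Lemma sicta_rhs_expansion (R : realType) (d n j : nat) (i a : 'I_d -> nat) :
  (2 <= n)%N -> (\sum_(m < d) i m = n)%N ->
  (forall m, (i m <= 1)%N -> a m = 1%N) ->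
  stop_expansion R j i a = (sicta_rhs n i a == j)%N%:R.
Proof.
move=> n2 sum_i ia.
have d0 : (0 < d)%N.
  by case: d i a sum_i ia => // i a; rewrite big_ord0; lia.
apply: stop_expansionE => //.
- rewrite (stop_index_le n2 sum_i) // /tail_sum big_pred0 // => m.
  by rewrite leqNgt ltn_ord.
- by move=> k kd; rewrite (stop_index_le n2 sum_i) // ltnW.
Qed.

Lemma small_expansion (R : realType) (d j : nat) (i a : 'I_d -> nat) :
  (0 < d)%N -> (\sum_(m < d) i m <= 1)%N ->
  (forall m, (i m <= 1)%N -> a m = 1%N) ->
  stop_expansion R j i a = (1 == j)%N%:R.
Proof.
move=> d0 sum_i ia; rewrite (stop_expansionE R j (M := 0)) //.
  by rewrite head_sum0 addn0 d0.
move=> k kd; rewrite leq0n; apply/esym; apply: leq_trans sum_i.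
by rewrite -(head_tail_sum k i) leq_addl.
Qed.

(** * Limits of sums over simplices, and dominated convergence for series *)

Lemma cvg_sum_fin (R : realType) (I : finType) (P : pred I)
    (f : I -> nat -> R) (l : I -> R) :
  (forall i, P i -> f i @ \oo --> l i) ->
  (fun N => \sum_(i | P i) f i N) @ \oo --> \sum_(i | P i) l i.
Proof. by move=> fl; apply: cvg_big => //; exact: add_continuous. Qed.

Lemma cvg_prod_fin (R : realType) (I : finType) (P : pred I)
    (f : I -> nat -> R) (l : I -> R) :
  (forall i, P i -> f i @ \oo --> l i) ->
  (fun N => \prod_(i | P i) f i N) @ \oo --> \prod_(i | P i) l i.
Proof. by move=> fl; apply: cvg_big => //; exact: mul_continuous. Qed.

(** The simplex of the i with sum below N contains the box of side N / (d + 1)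
    and is contained in the box of side N; over a box the sum of products is
    the product of partial sums, so both bounds converge to the product. *)
Lemma cvg_simplex_sum (R : realType) (d : nat) (u : 'I_d -> nat -> R)
    (s : 'I_d -> R) :
  (forall m n, 0 <= u m n) -> (forall m, series (u m) @ \oo --> s m) ->
  (fun N => \sum_(i : {ffun 'I_d -> 'I_N} | (\sum_m i m < N)%N)
     \prod_m u m (i m)) @ \oo --> \prod_m s m.
Proof.
move=> u0 us.
pose box N : R := \prod_m series (u m) N.
have cvg_box : box @ \oo --> \prod_m s m by apply: cvg_prod_fin => m _.
(* Over the index type of side N the boxes compare termwise with the
   simplex. *)
have boxE K N : (K <= N)%N -> box K =
    \sum_(i : {ffun 'I_d -> 'I_N} | [forall m, (i m < K)%N]) \prod_m u m (i m).
  move=> KN; rewrite /box.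
  transitivity (\prod_m \sum_(n < N) (n < K)%N%:R * u m n).
    apply: eq_bigr => m _; rewrite /series /= big_mkord.
    rewrite (big_ord_widen N (u m) KN) big_mkcond /=.
    by apply: eq_bigr => n _; case: ifP; rewrite ?mul1r ?mul0r.
  rewrite bigA_distr_bigA [RHS]big_mkcond /=; apply: eq_bigr => i _.
  rewrite big_split /= (prod_natr_forall R xpredT (fun m => i m < K)%N) /=.
  by case: ifP; rewrite ?mul1r ?mul0r.
have cvg_box' : box (N %/ d.+1)%N @[N --> \oo] --> \prod_m s m.
  by apply: (cvg_comp (fun N => N %/ d.+1)%N box) cvg_box; exact: cvg_divnr.
apply: squeeze_cvgr cvg_box' cvg_box.
near=> N.
have N0 : (0 < N)%N by near: N; exists 1%N.
have prod_ge0 (i : {ffun 'I_d -> 'I_N}) : 0 <= \prod_m u m (i m).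
  by apply: prodr_ge0.
apply/andP; split.
- rewrite (boxE _ N) ?leq_div // big_mkcond [leRHS]big_mkcond /=.
  apply: ler_sum => i _; case: ifP => [/forallP iK|_]; last by case: ifP.
  suff -> : (\sum_m i m < N)%N by [].
  apply: (@leq_ltn_trans (\sum_(m < d) (N %/ d.+1).-1)%N).
    apply: leq_sum => m _; have := iK m; lia.
  rewrite sum_nat_const card_ord.
  have := leq_divM N d.+1.
  nia.
- rewrite (boxE N N) //.
  rewrite [leRHS](eq_bigl xpredT); last by move=> i; apply/forallP.
  by rewrite [leLHS]big_mkcond; apply: ler_sum => i _; case: ifP.
Unshelve. all: by end_near. Qed.

(** Truncating all series at N costs at most the tail of the dominating series,
    uniformly in J, and the truncated sums converge termwise. *)
Lemma tannery (R : realType) (u : nat -> nat -> R) (v w : nat -> R) :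
  (forall J n, `|u J n| <= w n) -> (forall n, u ^~ n @ \oo --> v n) ->
  cvgn (series w) ->
  cvgn (series v) /\
  (fun J => limn (series (u J))) @ \oo --> limn (series v).
Proof.
move=> uw uv cw.
have w0 n : 0 <= w n by apply: le_trans (uw 0%N n).
have vw n : `|v n| <= w n.
  have /cvg_norm uvn := uv n.
  apply: (cvgr_to_le uvn); exact: nearW.
have abs_cvg (f : nat -> R) : (forall n, `|f n| <= w n) -> cvgn (series f).
  by move=> fw; apply: normed_cvg; apply: (series_le_cvg _ _ fw).
have cv := abs_cvg _ vw.
have cu J := abs_cvg _ (uw J).
split => //.
have tail_cvg : (limn (series w) - series w N) @[N --> \oo] --> (0 : R).
  rewrite -(subrr (limn (series w))); apply: cvgB => //; exact: cvg_cst.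
have tail_le (f : nat -> R) N : (forall n, `|f n| <= w n) ->
    `|limn (series f) - series f N| <= limn (series w) - series w N.
  move=> fw; have cf := abs_cvg _ fw.
  have cfN : `|series f M - series f N| @[M --> \oo]
      --> `|limn (series f) - series f N|.
    by apply: cvg_norm; apply: cvgB => //; exact: cvg_cst.
  have cwN : (series w M - series w N) @[M --> \oo]
      --> limn (series w) - series w N.
    by apply: cvgB => //; exact: cvg_cst.
  apply: (ler_cvg_to cfN cwN); near=> M.
  have NM : (N <= M)%N by near: M; exists N.
  rewrite !sub_series_geq //.
  by apply: le_trans (ler_norm_sum _ _ _) _; apply: ler_sum => n _.
apply/cvgrPdist_lt => e e0.
have e3 : 0 < e / 3%:R by rewrite divr_gt0.
have /cvgrPdist_lt/(_ _ e3) [N _ /(_ N (leqnn N))/=] := tail_cvg.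
rewrite sub0r normrN => HN.
have sum_cvg : series (u J) N @[J --> \oo] --> series v N.
  rewrite /series /= big_mkord.
  under eq_fun do rewrite big_mkord.
  by apply: cvg_sum_fin => n _.
near=> J.
have HJ : `|series v N - series (u J) N| < e / 3%:R.
  by near: J; move/cvgrPdist_lt: sum_cvg; exact.
have Hv := le_lt_trans (tail_le v N vw) (le_lt_trans (ler_norm _) HN).
have Hu := le_lt_trans (tail_le (u J) N (uw J)) (le_lt_trans (ler_norm _) HN).
have -> : limn (series v) - limn (series (u J)) =
  (limn (series v) - series v N) + (series v N - series (u J) N)
   - (limn (series (u J)) - series (u J) N) by lra.
apply: le_lt_trans (ler_normB _ _) _.
apply: le_lt_trans (lerD (ler_normD _ _) (lexx _)) _.
lra.
Unshelve. all: by end_near. Qed.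

(** * Poisson weights *)

(** The probability of n under the Poisson law of mean x; at x = 0 it is the
    point mass at 0, as cells with p_m = 0 require. *)
Definition poisson_weight (R : realType) (x : R) (n : nat) : R :=
  expR (- x) * (x ^+ n / n`!%:R).

Lemma poisson_weight_ge0 (R : realType) (x : R) (n : nat) :
  0 <= x -> 0 <= poisson_weight x n.
Proof. by move=> x0; rewrite mulr_ge0 ?expR_ge0 ?divr_ge0 ?exprn_ge0. Qed.

Lemma cvg_poisson_weight (R : realType) (x : R) :
  series (poisson_weight x) @ \oo --> (1 : R).
Proof.
rewrite -[X in _ --> X](expRxMexpNx_1 x) mulrC.
have -> : series (poisson_weight x) = expR (- x) \*o series (exp_coeff x).
  by apply/funext => N; rewrite /series /= mulr_sumr.
by apply: cvgMr; exact: is_cvg_series_exp_coeff.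
Qed.

(** * One step of the distributional recursion *)

Lemma measurable_preimage_countable (dT : measure_display)
    (T : measurableType dT) (E : countType) (X : T -> E) (D : set E) :
  (forall e, measurable (X @^-1` [set e])) -> measurable (X @^-1` D).
Proof.
move=> mX.
have -> : X @^-1` D = \bigcup_(k in [set k | exists2 e, D e & pickle e = k])
    (if unpickle k is Some e then X @^-1` [set e] else set0).
  apply/seteqP; split=> [w Dw|w [_ [e De <-]]].
    by exists (pickle (X w)); [exists (X w)|rewrite pickleK].
  by rewrite pickleK /preimage /= => ->.
by apply: bigcup_measurable => k _; case: unpickle.
Qed.

Lemma probability_countable_null (R : realType) (dT : measure_display)
    (T : measurableType dT) (P : probability T R) (E : countType) (X : T -> E)
    (D : set E) :
  (forall e, measurable (X @^-1` [set e])) ->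
  (forall e, D e -> P (X @^-1` [set e]) = 0%E) -> P (X @^-1` D) = 0%E.
Proof.
move=> mX D0; apply: measure_negligible.
  exact: measurable_preimage_countable.
pose F k : set T := if unpickle k is Some e then
  (if `[< D e >] then X @^-1` [set e] else set0) else set0.
apply: (@negligibleS _ _ _ _ (\bigcup_k F k)).
  move=> w Dw; exists (pickle (X w)) => //.
  by rewrite /F pickleK; case: asboolP.
apply: negligible_bigcup => k; rewrite /F.
case: unpickle => [e|]; last exact: negligible_set0.
by case: asboolP => [/D0 P0|_]; [apply/negligibleP|exact: negligible_set0].
Qed.

(** A countably valued variable only sees its atoms of positive probability; if
    those satisfying Q are finitely many, enumerated by f, then the probability
    of Q is a finite sum. *)
Lemma probability_finite_atoms (R : realType) (dT : measure_display)
    (T : measurableType dT) (P : probability T R) (E : countType) (Ef : finType)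
    (f : Ef -> E) (X : T -> E) (Q : pred E) :
  injective f -> (forall e, measurable (X @^-1` [set e])) ->
  (forall e, Q e -> P (X @^-1` [set e]) != 0%E -> exists e', e = f e') ->
  P (X @^-1` [set` Q]) = (\sum_(e' | Q (f e')) P (X @^-1` [set f e']))%E.
Proof.
move=> f_inj mX Qf.
pose U := [set e | Q e /\ exists e', e = f e'].
pose N := [set e | Q e /\ ~ exists e', e = f e'].
have -> : X @^-1` [set` Q] = (X @^-1` U) `|` (X @^-1` N).
  rewrite -preimage_setU; congr (_ @^-1` _); apply/seteqP; split=> [e Qe|e].
    by case: (pselect (exists e', e = f e')); [left|right].
  by case=> -[].
have mX' D := @measurable_preimage_countable _ _ _ X D mX.
rewrite measureU ?mX' //; last first.
  by rewrite -preimage_setI; apply/seteqP; split=> // w [[_ +] [_]].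
rewrite [X in (_ + X)%E](@probability_countable_null _ _ _ _ _ X) //.
  rewrite adde0.
  have -> : X @^-1` U =
      \bigcup_(e' in [set` [pred e' | Q (f e')]]) (X @^-1` [set f e']).
    apply/seteqP; split=> [w [Qw [e' we']]|w [e' Qe' we']].
      by exists e' => //=; rewrite inE -we'.
    by split; [rewrite we'|exists e'].
  rewrite measure_fin_bigcup; last first.
  - by move=> e' _.
  - move=> e1 e2 _ _ [w [/= w1 w2]]; apply: f_inj; congruence.
  - exact: finite_finset.
  rewrite -(@bigfs _ _ _ _ (index_enum Ef)) ?index_enum_uniq // => e'.
  by rewrite mem_index_enum.
move=> e [Qe nf]; apply/eqP; apply: contra_notT nf => /(Qf _ Qe).
exact.
Qed.

Definition law (R : realType) (dT : measure_display) (T : measurableType dT)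
    (P : probability T R) (l : nat -> {RV P >-> nat}) (n j : nat) : R :=
  fine (P (l n @^-1` [set j])).

Lemma law_ge0 (R : realType) (dT : measure_display) (T : measurableType dT)
    (P : probability T R) (l : nat -> {RV P >-> nat}) (n j : nat) :
  0 <= law l n j.
Proof. exact: fine_ge0. Qed.

Lemma lawE (R : realType) (dT : measure_display) (T : measurableType dT)
    (P : probability T R) (l : nat -> {RV P >-> nat}) (n j : nat) :
  P (l n @^-1` [set j]) = (law l n j)%:E.
Proof.
by rewrite /law fineK // fin_num_measure //; exact: measurable_funPTI.
Qed.

Lemma law_le1 (R : realType) (dT : measure_display) (T : measurableType dT)
    (P : probability T R) (l : nat -> {RV P >-> nat}) (n j : nat) :
  law l n j <= 1.
Proof.
by rewrite -lee_fin -lawE; apply: probability_le1; exact: measurable_funPTI.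
Qed.

Lemma law_init (R : realType) (d : nat) (p : d.-tuple R)
    (dT : measure_display) (T : measurableType dT) (P : probability T R)
    (l : nat -> {RV P >-> nat}) (n j : nat) :
  is_sicta p l -> (n <= 1)%N -> law l n j = (j == 1)%N%:R.
Proof.
move=> [l0 l1 _] n1.
have Pn1 : P (l n @^-1` [set 1%N]) = 1%E by case: n n1 => [|[]].
have [->|j1] := eqVneq j 1%N; first by rewrite /law Pn1.
apply/eqP; rewrite mulr0n eq_le law_ge0 andbT -lee_fin -lawE.
have := probability_setC P (measurable_funPTI (l n) (Y := [set 1%N]) I).
rewrite Pn1 subee // => PC.
have -> : 0%:E = P (~` (l n @^-1` [set 1%N])) by rewrite PC.
apply: le_measure; rewrite ?inE.
- exact: measurable_funPTI.
- by apply: measurableC; exact: measurable_funPTI.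
- by move=> w /= -> /eqP; rewrite (negbTE j1).
Qed.

(** Since l_0 = l_1 = 1 almost surely, an outcome of positive probability has
    length 1 in every cell with at most one packet. *)
Lemma law_neq0_small (R : realType) (d : nat) (p : d.-tuple R)
    (dT : measure_display) (T : measurableType dT) (P : probability T R)
    (l : nat -> {RV P >-> nat}) (i a : 'I_d -> nat) :
  is_sicta p l -> \prod_(m < d) law l (i m) (a m) != 0 ->
  forall m, (i m <= 1)%N -> a m = 1%N.
Proof.
move=> hl prod_neq0 m im; apply/eqP; apply: contraNT prod_neq0 => am.
by rewrite (bigD1 m) //= (law_init _ hl) // (negbTE am) mul0r.
Qed.

(** Before the stopping index an entry is a summand of the right-hand side;
    after it the cell holds at most one packet, so that the entry is 1. *)
Lemma sicta_rhs_entry_le (d n : nat) (i a : 'I_d -> nat) (m : 'I_d) :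
  (2 <= n)%N -> (\sum_(m < d) i m = n)%N ->
  (forall m, (i m <= 1)%N -> a m = 1%N) ->
  (a m < (sicta_rhs n i a).+2)%N.
Proof.
move=> n2 sum_i ia.
have := stop_index_le n2 sum_i; rewrite /sicta_rhs /=.
set M := stop_index n i => HM.
have [mM|Mm] := ltnP m M.
  by rewrite (bigD1 m) //=; lia.
rewrite ia //; apply: leq_trans (leq_tail_sum i Mm) _.
by rewrite -HM //; apply: leq_trans Mm (ltnW (ltn_ord m)).
Qed.

Local Notation vals i := (fun m => nat_of_ord (i m)).

(** The recursion as a finite sum.  The bound N on the counts is only required
    to exceed n, so that one index type serves all n < N at once. *)
Lemma law_step (R : realType) (d : nat) (p : d.-tuple R)
    (dT : measure_display) (T : measurableType dT) (P : probability T R)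
    (l : nat -> {RV P >-> nat}) (n N j : nat) :
  is_sicta p l -> (2 <= n)%N -> (n < N)%N ->
  law l n j = \sum_(i : {ffun 'I_d -> 'I_N} | (\sum_m i m == n)%N)
    \sum_(a : {ffun 'I_d -> 'I_j.+2}) (sicta_rhs n (vals i) (vals a) == j)%:R *
      (multinomial_pmf p n (vals i) * \prod_m law l (i m) (a m)).
Proof.
move=> hl n2 nN; have [_ _ /(_ n n2)] := hl.
move=> [dT' [T' [P' [I [L [PI PL PR]]]]]].
pose E : countType := ({ffun 'I_d -> nat} * {ffun 'I_d -> nat})%type.
pose X w : E := ([ffun m => I m w], [ffun m => L m w]).
have XE (e : E) : X @^-1` [set e] =
    [set w | forall m, I m w = e.1 m /\ L m w = e.2 m].
  apply/seteqP; split=> w /=.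
    by move=> <- m; rewrite !ffunE.
  by case: e => i a /= ia; congr pair; apply/ffunP => m; rewrite !ffunE;
    have [] := ia m.
have mX e : measurable (X @^-1` [set e]).
  rewrite XE.
  have -> : [set w | forall m, I m w = e.1 m /\ L m w = e.2 m] =
    \bigcap_(m in setT) ((I m @^-1` [set e.1 m]) `&` (L m @^-1` [set e.2 m])).
    by apply/seteqP; split=> w /= h m; [move=> _|]; apply: h.
  apply: fin_bigcap_measurable; first exact: finite_finset.
  by move=> m _; apply: measurableI; exact: measurable_funPTI.
have PX (e : E) : P' (X @^-1` [set e]) =
    (multinomial_pmf p n e.1 * \prod_m law l (e.1 m) (e.2 m))%:E.
  rewrite XE PL PI EFinM; congr (_ * _)%E.
  by rewrite -prodEFin; apply: eq_bigr => m _; rewrite lawE.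
pose Ef : finType := ({ffun 'I_d -> 'I_N} * {ffun 'I_d -> 'I_j.+2})%type.
pose f (e : Ef) : E := ([ffun m => e.1 m : nat], [ffun m => e.2 m : nat]).
have f_inj : injective f.
  move=> [i a] [i' a'] [/ffunP ii' /ffunP aa']; congr pair; apply/ffunP => m;
    apply/val_inj.
  - by have := ii' m; rewrite !ffunE.
  - by have := aa' m; rewrite !ffunE.
pose Q : pred E := fun e => sicta_rhs n e.1 e.2 == j.
have Qf e : Q e -> P' (X @^-1` [set e]) != 0%E -> exists e', e = f e'.
  rewrite PX eqe mulf_eq0 negb_or => /eqP Qe /andP[mult_neq0 prod_neq0].
  have sum_e : (\sum_(m < d) e.1 m)%N = n.
    move: mult_neq0; rewrite /multinomial_pmf; case: ifP => [/eqP //|_].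
    by rewrite eqxx.
  have e_small := law_neq0_small hl prod_neq0.
  have e1N m : (e.1 m < N)%N.
    by apply: leq_ltn_trans nN; rewrite -sum_e (bigD1 m) //= leq_addr.
  have e2j m : (e.2 m < j.+2)%N.
    by rewrite -Qe; apply: sicta_rhs_entry_le.
  exists ([ffun m => Ordinal (e1N m)], [ffun m => Ordinal (e2j m)]).
  rewrite /f /=.
  case: e {Qe mult_neq0 prod_neq0 sum_e e_small} e1N e2j => i a /=.
  by move=> iN aj; congr pair; apply/ffunP => m; rewrite !ffunE.
have rhsE : (fun w => sicta_rhs n (I ^~ w) (L ^~ w)) @^-1` [set j] =
    X @^-1` [set` Q].
  have QX w : Q (X w) = (sicta_rhs n (I ^~ w) (L ^~ w) == j).
    rewrite /Q /X /=; congr (sicta_rhs _ _ _ == _);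
      by apply/funext => m; rewrite ffunE.
  apply/seteqP; split=> w /=.
    by move=> /eqP h; change (is_true (Q (X w))); rewrite QX.
  by move=> h; have : Q (X w) := h; rewrite QX => /eqP.
have := PR [set j]; rewrite /distribution /pushforward lawE rhsE.
rewrite (probability_finite_atoms f_inj mX Qf).
under eq_bigr do rewrite PX.
rewrite sumEFin => -[->].
rewrite [RHS]pair_big /= [LHS]big_mkcond [RHS]big_mkcond /=.
apply: eq_bigr => -[i a] _ /=.
have -> : Q (f (i, a)) = (sicta_rhs n (vals i) (vals a) == j).
  rewrite /Q /f /=; congr (sicta_rhs _ _ _ == _);
    by apply/funext => m; rewrite ffunE.
have fE : multinomial_pmf p n [ffun m => i m : nat] *
    \prod_m law l ([ffun m => i m : nat] m) ([ffun m => a m : nat] m) =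
    multinomial_pmf p n (vals i) * \prod_m law l (i m) (a m).
  congr (multinomial_pmf p n _ * _); first by apply/funext => m; rewrite ffunE.
  by apply: eq_bigr => m _; rewrite !ffunE.
rewrite fE; case: eqP => _; rewrite ?mul1r ?mul0r; last by case: ifP.
by rewrite /multinomial_pmf andbT; case: ifP => // _; rewrite mul0r.
Qed.

(** If M < d the indicator is already 1.  Otherwise at least two packets fall
    into the last cell, so the first cell, distinct from it as d >= 2, has
    fewer than n packets and positive length by induction. *)
Lemma law_at0 (R : realType) (d : nat) (p : d.-tuple R)
    (dT : measure_display) (T : measurableType dT) (P : probability T R)
    (l : nat -> {RV P >-> nat}) (n : nat) :
  (2 <= d)%N -> is_sicta p l -> law l n 0 = 0.
Proof.
move=> hd hl; elim/ltn_ind: n => n IH.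
have [n1|n2] := leqP n 1; first by rewrite (law_init _ hl).
rewrite (law_step _ hl n2 (ltnSn n)) big1 // => i /eqP sum_i.
rewrite big1 // => a _.
have [|_] := eqVneq (sicta_rhs n (vals i) (vals a)) 0%N; last by rewrite mul0r.
rewrite mul1r /sicta_rhs /=; have stop_le := stop_index_le n2 sum_i.
set M := stop_index n (vals i) in stop_le *.
case: ltnP => // dM /eqP; rewrite add0n sum_nat_eq0 => /forallP/= a0.
have d0 : (0 < d)%N by exact: ltnW.
have am0 : nat_of_ord (a (Ordinal d0)) = 0%N.
  by apply/eqP; have /implyP := a0 (Ordinal d0); apply; exact: leq_trans dM.
rewrite (bigD1 (Ordinal d0)) //= am0 IH ?mul0r ?mulr0 //.
have tail2 : (1 < tail_sum d.-1 (vals i))%N.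
  by rewrite ltnNge -stop_le ?leq_pred //; lia.
have := head_tail_sum d.-1 (vals i); rewrite sum_i => sum_n.
have head_lt : (head_sum d.-1 (vals i) < n)%N by lia.
apply: leq_ltn_trans head_lt.
by rewrite /head_sum (bigD1 (Ordinal d0)) ?leq_addr //=; lia.
Qed.

(** * Poissonization of the recursion *)

(** Poisson thinning: splitting a Poisson number of packets multinomially gives
    independent Poisson counts. *)
Lemma poisson_weight_multinomial (R : realType) (d : nat) (p : d.-tuple R)
    (x : R) (n : nat) (i : 'I_d -> nat) :
  \sum_(m < d) p`_m = 1 -> (\sum_(m < d) i m)%N = n ->
  poisson_weight x n * multinomial_pmf p n i =
  \prod_(m < d) poisson_weight (x * p`_m) (i m).
Proof.
move=> p1 sum_i; rewrite /multinomial_pmf sum_i eqxx /poisson_weight.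
rewrite big_split /= -expR_sum sumrN -mulr_sumr p1 mulr1 -!mulrA; congr (_ * _).
under [RHS]eq_bigr do rewrite exprMn.
rewrite big_split big_split /= prodfV natr_prod.
rewrite -expr_sum sum_i -!mulrA; congr (_ * _).
by rewrite mulKf ?pnatr_eq0 -?lt0n ?fact_gt0 // mulrC.
Qed.

(** Independent Poisson counts on the cells of A have total at most 1 with the
    probability that a Poisson variable of the summed mean does; for A the
    cells from k on this is f_k. *)
Lemma prod_poisson_weight_le1 (R : realType) (I : finType) (A : pred I)
    (p : I -> R) (x : R) :
  \prod_(m | A m) poisson_weight (x * p m) 0 +
  \sum_(t | A t) \prod_(m | A m) poisson_weight (x * p m) (m == t) =
  (1 + (\sum_(m | A m) p m) * x) * expR (- ((\sum_(m | A m) p m) * x)).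
Proof.
have prod_expR : \prod_(m | A m) expR (- (x * p m)) =
    expR (- ((\sum_(m | A m) p m) * x)).
  by rewrite -expR_sum sumrN -mulr_sumr mulrC.
under eq_bigr do rewrite /poisson_weight expr0 fact0 divr1 mulr1.
rewrite prod_expR mulrDl mul1r; congr (_ + _).
set E := expR _ in prod_expR *.
rewrite mulr_suml mulr_suml; apply: eq_bigr => t At.
rewrite /poisson_weight big_split /= prod_expR mulrC; congr (_ * _).
rewrite (bigD1 t) //= eqxx expr1 divr1 big1 ?mulr1 1?mulrC //.
by move=> m /andP[_ /negbTE ->]; rewrite expr0 divr1.
Qed.

Lemma sum_pointmass (R : realType) (N c : nat) (v : nat -> R) :
  (c < N)%N -> \sum_(n < N) (n == c :> nat)%:R * v n = v c.
Proof.
move=> cN; rewrite (bigD1 (Ordinal cN)) //= eqxx mul1r big1 ?addr0 // => n.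
by rewrite -val_eqE /= => /negbTE ->; rewrite mul0r.
Qed.

Lemma sum_ffun_le1 (R : realType) (d N : nat) (v : 'I_d -> nat -> R) :
  (1 < N)%N ->
  \sum_(i : {ffun 'I_d -> 'I_N} | (\sum_m i m <= 1)%N) \prod_m v m (i m) =
  \prod_m v m 0%N + \sum_t \prod_m v m (m == t).
Proof.
move=> N1; rewrite big_mkcond /=.
have split_le1 (i : {ffun 'I_d -> 'I_N}) :
    (if (\sum_m i m <= 1)%N then \prod_m v m (i m) else 0) =
    \prod_m ((i m == 0%N :> nat)%:R * v m (i m)) +
    \sum_t \prod_m ((i m == (m == t) :> nat)%:R * v m (i m)).
  rewrite big_split /=; under [X in _ + X]eq_bigr do rewrite big_split /=.
  rewrite -mulr_suml -mulrDl -(sum_le1_natr R xpredT (vals i)).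
  by case: ifP; rewrite ?mul1r ?mul0r.
under eq_bigr do rewrite split_le1.
rewrite big_split /= exchange_big /=; congr (_ + _).
- rewrite -(bigA_distr_bigA (fun m (n : 'I_N) => (n == 0%N :> nat)%:R * v m n)).
  by apply: eq_bigr => m _; rewrite sum_pointmass // ltnW.
- apply: eq_bigr => t _.
  rewrite -(bigA_distr_bigA
    (fun m (n : 'I_N) => (n == (m == t) :> nat)%:R * v m n)).
  by apply: eq_bigr => m _; rewrite sum_pointmass //; case: (m == t); lia.
Qed.

(** With at most one packet in total all lengths are 1 almost surely. *)
Lemma sum_law_stop_expansion (R : realType) (d : nat) (p : d.-tuple R)
    (dT : measure_display) (T : measurableType dT) (P : probability T R)
    (l : nat -> {RV P >-> nat}) (j : nat) (i : 'I_d -> nat) :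
  (0 < d)%N -> is_sicta p l -> (\sum_(m < d) i m <= 1)%N ->
  \sum_(a : {ffun 'I_d -> 'I_j.+2})
    (\prod_m law l (i m) (a m)) * stop_expansion R j i (vals a) =
  (1 == j)%N%:R.
Proof.
move=> d0 hl sum_i.
transitivity (\sum_(a : {ffun 'I_d -> 'I_j.+2})
    (\prod_m law l (i m) (a m)) * (1 == j)%N%:R).
  apply: eq_bigr => a _.
  have [->|law_neq0] := eqVneq (\prod_m law l (i m) (a m)) 0.
    by rewrite !mul0r.
  by rewrite small_expansion //; exact: law_neq0_small hl law_neq0.
rewrite -mulr_suml -[RHS]mul1r; congr (_ * _).
rewrite -(bigA_distr_bigA (fun m (n : 'I_j.+2) => law l (i m) n)).
apply: big1 => m _.
rewrite -[RHS](sum_pointmass (fun=> 1) (isT : (1 < j.+2)%N)).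
apply: eq_bigr => n _; rewrite mulr1; apply: law_init hl _.
by apply: leq_trans sum_i; rewrite (bigD1 m) //= leq_addr.
Qed.

(** The counts of total n >= 2 come from the recursion.  Those of total 0 and 1,
    to which the recursion does not apply, contribute the same amount on both
    sides, namely (1 + x) exp(- x) when j = 1. *)
Lemma series_lawE (R : realType) (d : nat) (p : d.-tuple R)
    (dT : measure_display) (T : measurableType dT) (P : probability T R)
    (l : nat -> {RV P >-> nat}) (j : nat) (x : R) (N : nat) :
  (0 < d)%N -> \sum_(m < d) p`_m = 1 -> is_sicta p l -> (1 < N)%N ->
  series (fun n => law l n j * poisson_weight x n) N =
  \sum_(i : {ffun 'I_d -> 'I_N} | (\sum_m i m < N)%N)
    (\prod_(m < d) poisson_weight (x * p`_m) (i m)) *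
    \sum_(a : {ffun 'I_d -> 'I_j.+2})
      (\prod_m law l (i m) (a m)) * stop_expansion R j (vals i) (vals a).
Proof.
move=> d0 p1 hl N1.
set F := fun i : {ffun 'I_d -> 'I_N} =>
    \prod_(m < d) poisson_weight (x * p`_m) (i m) *
    \sum_(a : {ffun 'I_d -> 'I_j.+2})
      (\prod_m law l (i m) (a m)) * stop_expansion R j (vals i) (vals a).
have large n : (2 <= n)%N -> (n < N)%N -> law l n j * poisson_weight x n =
    \sum_(i : {ffun 'I_d -> 'I_N} | (\sum_m i m == n)%N) F i.
  move=> n2 nN; rewrite (law_step j hl n2 nN) mulr_suml.
  apply: eq_bigr => i /eqP sum_i; rewrite /F mulr_suml mulr_sumr.
  apply: eq_bigr => a _.
  rewrite -(poisson_weight_multinomial x p1 sum_i).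
  have [->|law_neq0] := eqVneq (\prod_m law l (i m) (a m)) 0.
    by rewrite !(mulr0, mul0r).
  rewrite (sicta_rhs_expansion R j n2 sum_i (law_neq0_small hl law_neq0)).
  ring.
have small : \sum_(i : {ffun 'I_d -> 'I_N} | (\sum_m i m <= 1)%N) F i =
    law l 0 j * poisson_weight x 0 + law l 1 j * poisson_weight x 1.
  transitivity (\sum_(i : {ffun 'I_d -> 'I_N} | (\sum_m i m <= 1)%N)
      \prod_(m < d) poisson_weight (x * p`_m) (i m) * (1 == j)%N%:R).
    by apply: eq_bigr => i sum_i; rewrite /F (sum_law_stop_expansion _ _ hl).
  rewrite -mulr_suml.
  rewrite (sum_ffun_le1 (fun m => poisson_weight (x * p`_m))) //.
  rewrite (prod_poisson_weight_le1 xpredT (fun m : 'I_d => p`_m)) p1.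
  rewrite !(law_init _ hl) // /poisson_weight eq_sym expr0 expr1 !divr1 !mul1r.
  by rewrite mulr1 -mulrDr mulrC; congr (_ * _); ring.
rewrite [RHS](bigID (fun i : {ffun 'I_d -> 'I_N} => (\sum_m i m <= 1)%N)) /=.
rewrite [X in _ = X + _](eq_bigl (fun i : {ffun 'I_d -> 'I_N} =>
  (\sum_m i m <= 1)%N)); last by move=> i /=; lia.
rewrite small /series /= big_ltn 1?big_ltn ?(ltnW N1) // addrA; congr (_ + _).
rewrite (eq_big_nat _ _ (F2 := fun n =>
   \sum_(i : {ffun 'I_d -> 'I_N} | (\sum_m i m == n)%N) F i)); last first.
  by move=> n /andP[n2 nN]; exact: large.
under eq_bigr do rewrite big_mkcond /=.
rewrite exchange_big /= [RHS]big_mkcond /=; apply: eq_bigr => i _.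
case: ifP => [/andP[iN i2]|iN].
  rewrite (big_rem (\sum_m i m)%N) ?mem_index_iota /=; last by lia.
  rewrite eqxx big_seq big1 ?addr0 // => n.
  rewrite mem_rem_uniq ?iota_uniq // inE => /andP[/negbTE].
  by rewrite eq_sym => ->.
rewrite big_nat big1 // => n /andP[n2 nN]; case: eqP => // E; lia.
Qed.

(** Extends a composition of j into k parts by ones to a family indexed by all
    d cells, so that all convolutions are sums over one index type. *)
Lemma Qconv_widen (R : realType) (d : nat) (p : d.-tuple R)
    (g : nat -> R -> R) (k : nat) (x : R) (j B : nat) :
  (k <= d)%N -> (j < B.+1)%N -> (1 < B.+1)%N ->
  Qconv p g k x j = \sum_(a : {ffun 'I_d -> 'I_B.+1})
    (head_sum k (vals a) == j)%N%:R *
    ([forall m : 'I_d, (k <= m)%N ==> (a m == 1%N :> nat)]%:R *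
     \prod_(m < d | (m < k)%N) g (a m) (x * p`_m)).
Proof.
move=> kd jB B1; rewrite /Qconv.
pose h (mu : {ffun 'I_k -> 'I_j.+1}) : {ffun 'I_d -> 'I_B.+1} :=
  [ffun m : 'I_d => if insub (val m) is Some m' then inord (mu m')
                    else inord 1].
pose h' (a : {ffun 'I_d -> 'I_B.+1}) : {ffun 'I_k -> 'I_j.+1} :=
  [ffun m : 'I_k => inord (a (widen_ord kd m))].
have h_head mu (m : 'I_k) : h mu (widen_ord kd m) = mu m :> nat.
  rewrite ffunE /= valK inordK //.
  by apply: leq_trans (ltn_ord (mu m)) _.
have h_tail mu (m : 'I_d) : (k <= m)%N -> h mu m = 1%N :> nat.
  move=> km; rewrite ffunE insubF; first by rewrite inordK.
  by rewrite ltnNge km.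
transitivity (\sum_(a : {ffun 'I_d -> 'I_B.+1} |
   (head_sum k (vals a) == j)%N &&
   [forall m : 'I_d, (k <= m)%N ==> (a m == 1%N :> nat)])
     \prod_(m < d | (m < k)%N) g (a m) (x * p`_m)); last first.
  rewrite big_mkcond /=; apply: eq_bigr => a _.
  case: eqP => _ /=; rewrite ?mul0r // mul1r.
  by case: ifP => _; rewrite ?mul1r ?mul0r.
rewrite (reindex_onto h h') /=; last first.
  move=> a /andP[/eqP sum_a /forallP a1]; apply/ffunP => m; apply/val_inj => /=.
  have [mk|km] := ltnP m k.
    have -> : m = widen_ord kd (Ordinal mk) by apply/val_inj.
    rewrite h_head ffunE inordK // ltnS -sum_a /head_sum.
    by rewrite (bigD1 (widen_ord kd (Ordinal mk))) //= leq_addr.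
  by rewrite h_tail //; have := a1 m; rewrite km => /eqP ->.
have hK mu : h' (h mu) = mu.
  by apply/ffunP => m; apply/val_inj; rewrite ffunE /= inordK h_head.
apply: eq_big => [mu|mu _].
  rewrite hK eqxx andbT /head_sum (big_ord_narrow kd) /=.
  under [in RHS]eq_bigr do rewrite h_head.
  case: eqP => //= _; apply/esym/forallP => m; apply/implyP => km.
  by rewrite h_tail.
by rewrite (big_ord_narrow kd) /=; apply: eq_bigr => m _; rewrite h_head.
Qed.

(** * The recursive equation *)

Lemma cvg_sicta_q (R : realType) (dT : measure_display)
    (T : measurableType dT) (P : probability T R) (l : nat -> {RV P >-> nat})
    (j : nat) (x : R) : 0 <= x ->
  series (fun n => law l n j * poisson_weight x n) @ \oo --> sicta_q l j x.
Proof.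
move=> x0; rewrite /sicta_q; apply: (@series_le_cvg _ _ (poisson_weight x)).
- by move=> n; rewrite mulr_ge0 ?law_ge0 ?poisson_weight_ge0.
- by move=> n; exact: poisson_weight_ge0.
- move=> n; rewrite -[leRHS]mul1r ler_wpM2r ?poisson_weight_ge0 //.
  exact: law_le1.
- by apply/cvg_ex; exists 1; exact: cvg_poisson_weight.
Qed.

Lemma cvg_series_pointmass (R : realType) (v : nat -> R) (c : nat) :
  series (fun n => (n == c)%:R * v n) @ \oo --> v c.
Proof.
apply: cvg_near_cst; near=> N.
rewrite /series /= big_mkord (sum_pointmass v) //.
by near: N; exists c.+1.
Unshelve. all: by end_near. Qed.

(** By [sum_le1_natr] the event that at most one packet falls into the cells
    from k on is a sum of product events, to each of which [cvg_simplex_sum]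
    applies: the cells before k contribute q, and those from k on a single
    Poisson weight, nonzero only if the length is 1. *)
Lemma cvg_tail_le1 (R : realType) (d : nat) (p : d.-tuple R)
    (dT : measure_display) (T : measurableType dT) (P : probability T R)
    (l : nat -> {RV P >-> nat}) (x : R) (k : nat) (a : 'I_d -> nat) :
  (forall i : 'I_d, 0 <= p`_i) -> is_sicta p l -> 0 <= x ->
  (fun N => \sum_(i : {ffun 'I_d -> 'I_N} | (\sum_m i m < N)%N)
     (tail_sum k (vals i) <= 1)%N%:R *
     \prod_(m < d) (law l (i m) (a m) * poisson_weight (x * p`_m) (i m)))
  @ \oo -->
  f_ p k x * ([forall m : 'I_d, (k <= m)%N ==> (a m == 1%N)]%:R *
     \prod_(m < d | (m < k)%N) sicta_q l (a m) (x * p`_m)).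
Proof.
move=> p0 hl x0.
have xp0 (m : 'I_d) : 0 <= x * p`_m by rewrite mulr_ge0.
pose u (m : 'I_d) n := law l n (a m) * poisson_weight (x * p`_m) n.
have u0 m n : 0 <= u m n by rewrite mulr_ge0 ?law_ge0 ?poisson_weight_ge0.
pose uc (c : 'I_d -> nat) (m : 'I_d) n :=
  (if (k <= m)%N then (n == c m)%:R else 1) * u m n.
have cvg_uc (c : 'I_d -> nat) : (forall m, (c m <= 1)%N) ->
    (fun N => \sum_(i : {ffun 'I_d -> 'I_N} | (\sum_m i m < N)%N)
       \prod_m uc c m (i m)) @ \oo -->
    (\prod_(m < d | (k <= m)%N) poisson_weight (x * p`_m) (c m)) *
    ([forall m : 'I_d, (k <= m)%N ==> (a m == 1%N)]%:R *
     \prod_(m < d | (m < k)%N) sicta_q l (a m) (x * p`_m)).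
  move=> c1.
  have -> : (\prod_(m < d | (k <= m)%N) poisson_weight (x * p`_m) (c m)) *
    ([forall m : 'I_d, (k <= m)%N ==> (a m == 1%N)]%:R *
     \prod_(m < d | (m < k)%N) sicta_q l (a m) (x * p`_m)) =
     \prod_(m < d) (if (k <= m)%N then u m (c m) else
        sicta_q l (a m) (x * p`_m)).
    rewrite -(prod_natr_forall R (fun m : 'I_d => k <= m)%N
      (fun m => a m == 1%N)) mulrA -big_split /=.
    rewrite [RHS](bigID (fun m : 'I_d => (k <= m)%N)) /=; congr (_ * _).
      apply: eq_bigr => m km.
      by rewrite km /u (law_init _ hl) // mulrC.
    apply: eq_big => m; first by rewrite ltnNge.
    by rewrite ltnNge => /negbTE ->.
  apply: cvg_simplex_sum => m.
    by move=> n; rewrite /uc mulr_ge0 //; case: ifP.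
  rewrite /uc; case: ifP => km; first exact: cvg_series_pointmass.
  under eq_fun do rewrite mul1r.
  exact: cvg_sicta_q.
have splitE N (i : {ffun 'I_d -> 'I_N}) :
    (tail_sum k (vals i) <= 1)%N%:R * \prod_m u m (i m) =
    \prod_m uc (fun=> 0%N) m (i m) +
    \sum_(t < d | (k <= t)%N) \prod_m uc (fun m => m == t) m (i m).
  rewrite /tail_sum sum_le1_natr mulrDl mulr_suml.
  have ucE c : \prod_m uc c m (i m) =
      (\prod_(m < d | (k <= m)%N) (i m == c m :> nat)%:R) * \prod_m u m (i m).
    by rewrite /uc big_split /= -big_mkcond.
  by rewrite ucE; congr (_ + _); apply: eq_bigr => t _; rewrite ucE.
have sumE N : \sum_(i : {ffun 'I_d -> 'I_N} | (\sum_m i m < N)%N)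
     (tail_sum k (vals i) <= 1)%N%:R * \prod_m u m (i m) =
   \sum_(i : {ffun 'I_d -> 'I_N} | (\sum_m i m < N)%N)
     \prod_m uc (fun=> 0%N) m (i m) +
   \sum_(t < d | (k <= t)%N)
     \sum_(i : {ffun 'I_d -> 'I_N} | (\sum_m i m < N)%N)
       \prod_m uc (fun m => m == t) m (i m).
  under eq_bigr do rewrite splitE.
  by rewrite big_split exchange_big.
under eq_cvg do rewrite sumE.
have -> : f_ p k x =
    \prod_(m < d | (k <= m)%N) poisson_weight (x * p`_m) 0 +
    \sum_(t < d | (k <= t)%N) \prod_(m < d | (k <= m)%N)
       poisson_weight (x * p`_m) (m == t).
  rewrite (prod_poisson_weight_le1 _ (fun m : 'I_d => p`_m)) /f_ /Fbar.
  by rewrite big_geq_mkord.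
rewrite mulrDl mulr_suml; apply: cvgD; first exact: cvg_uc.
by apply: cvg_sum_fin => t _; apply: cvg_uc => m; case: (m == t).
Qed.

Lemma sicta_q_recursion (R : realType) (d : nat) (p : d.-tuple R)
    (dT : measure_display) (T : measurableType dT) (P : probability T R)
    (l : nat -> {RV P >-> nat}) (j : nat) (x : R) :
  (0 < d)%N -> (forall i : 'I_d, 0 <= p`_i) -> \sum_(m < d) p`_m = 1 ->
  is_sicta p l -> (1 <= j)%N -> 0 <= x ->
  sicta_q l j x = recursion_rhs p (sicta_q l) j x.
Proof.
move=> d0 p0 p1 hl j1 x0.
pose W N (k : nat) (a : {ffun 'I_d -> 'I_j.+2}) : R :=
  \sum_(i : {ffun 'I_d -> 'I_N} | (\sum_m i m < N)%N)
    (tail_sum k (vals i) <= 1)%N%:R *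
    \prod_(m < d) (law l (i m) (a m) * poisson_weight (x * p`_m) (i m)).
pose V k (a : {ffun 'I_d -> 'I_j.+2}) : R :=
  [forall m : 'I_d, (k <= m)%N ==> (a m == 1%N :> nat)]%:R *
  \prod_(m < d | (m < k)%N) sicta_q l (a m) (x * p`_m).
have cvgW k a : (fun N => W N k a) @ \oo --> f_ p k x * V k a.
  by have := @cvg_tail_le1 _ _ _ _ _ _ _ _ k (vals a) p0 hl x0.
have tail_d (i : 'I_d -> nat) : tail_sum d i = 0%N.
  by rewrite /tail_sum big_pred0 // => m; rewrite leqNgt ltn_ord.
have f_d : f_ p d x = 1.
  by rewrite /f_ /Fbar big_geq // mul0r oppr0 expR0 addr0 mulr1.
pose c (a : {ffun 'I_d -> 'I_j.+2}) : R := (head_sum d (vals a) == j)%:R.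
pose s k (a : {ffun 'I_d -> 'I_j.+2}) : R :=
  ((head_sum k (vals a)).+1 == j)%:R - ((head_sum k (vals a)).+2 == j)%:R.
have partialE N : (1 < N)%N ->
    series (fun n => law l n j * poisson_weight x n) N =
    \sum_a (c a * W N d a + \sum_(k < d.-1) s k a * W N k a).
  move=> N1; rewrite (series_lawE j x d0 p1 hl N1).
  under eq_bigr do rewrite mulr_sumr.
  rewrite exchange_big /=; apply: eq_bigr => a _; rewrite /W mulr_sumr.
  under [X in _ + X]eq_bigr do rewrite mulr_sumr.
  rewrite exchange_big -big_split /=; apply: eq_bigr => i _.
  have -> : \prod_(m < d) (law l (i m) (a m) * poisson_weight (x * p`_m) (i m))
      = (\prod_(m < d) law l (i m) (a m)) *
        \prod_(m < d) poisson_weight (x * p`_m) (i m) by exact: big_split.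
  rewrite tail_d mul1r /stop_expansion -/(c a).
  rewrite mulrA mulrDr mulr_sumr; congr (_ + _); first by ring.
  by apply: eq_bigr => k _; rewrite -/(s k a); ring.
have cvgR : series (fun n => law l n j * poisson_weight x n) @ \oo -->
    \sum_a (c a * (f_ p d x * V d a) +
      \sum_(k < d.-1) s k a * (f_ p k x * V k a)).
  apply: (@cvg_trans _ ((fun N =>
    \sum_a (c a * W N d a + \sum_(k < d.-1) s k a * W N k a)) @ \oo)).
    by apply: near_eq_cvg; near=> N; rewrite partialE //; near: N; exists 2%N.
  apply: cvg_sum_fin => a _; apply: cvgD.
    by apply: cvgM; [exact: cvg_cst|exact: cvgW].
  by apply: cvg_sum_fin => k _; apply: cvgM; [exact: cvg_cst|exact: cvgW].
rewrite -(cvg_lim (@Rhausdorff R) (@cvg_sicta_q _ _ _ _ l j _ x0)).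
rewrite (cvg_lim (@Rhausdorff R) cvgR).
rewrite big_split exchange_big /= /recursion_rhs f_d; congr (_ + _).
  rewrite (Qconv_widen _ _ _ (B := j.+1)) //.
  by apply: eq_bigr => a _; rewrite mul1r.
apply: eq_bigr => k _.
have kd : (k <= d)%N by apply: leq_trans (ltnW (ltn_ord k)) (leq_pred d).
rewrite (Qconv_widen _ _ _ (B := j.+1) kd) //; last by lia.
rewrite (Qconv_widen _ _ _ (B := j.+1) kd) //; last by lia.
rewrite j1 mulr1 mulr_suml -sumrB mulr_sumr; apply: eq_bigr => a _.
rewrite -/(V k a) /s.
have -> : ((head_sum k (vals a)).+1 == j) = (head_sum k (vals a) == (j - 1)%N).
  by lia.
have -> : ((head_sum k (vals a)).+2 == j) =
    (head_sum k (vals a) == (j - 2)%N) && (2 <= j)%N by lia.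
by rewrite -mulnb natrM; ring.
Unshelve. all: by end_near. Qed.

Lemma Qconv_eq_below (R : realType) (d : nat) (p : d.-tuple R)
    (g g' : nat -> R -> R) (k j J : nat) (x : R) :
  (k <= d)%N -> (forall i : 'I_d, 0 <= p`_i) -> 0 <= x -> (j < J)%N ->
  (forall (i : nat) (y : R), (i < J)%N -> 0 <= y -> g i y = g' i y) ->
  Qconv p g k x j = Qconv p g' k x j.
Proof.
move=> kd p0 x0 jJ gg'; apply: eq_bigr => mu _; apply: eq_bigr => m _.
apply: gg'; first exact: leq_trans (ltn_ord (mu m)) jJ.
by rewrite mulr_ge0 //; exact: (p0 (widen_ord kd m)).
Qed.

(** A part equal to j forces all other parts to be 0; there is one, as d >= 2,
    and its factor q_0 annihilates the product. *)
Lemma Qconv_eq_full (R : realType) (d : nat) (p : d.-tuple R)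
    (g g' : nat -> R -> R) (j : nat) (x : R) :
  (2 <= d)%N -> (forall i : 'I_d, 0 <= p`_i) -> 0 <= x -> (1 <= j)%N ->
  (forall y : R, 0 <= y -> g' 0%N y = 0) ->
  (forall (i : nat) (y : R), (i < j)%N -> 0 <= y -> g i y = g' i y) ->
  Qconv p g d x j = Qconv p g' d x j.
Proof.
move=> hd p0 x0 j1 g0 gg'; apply: eq_bigr => mu /eqP sum_mu.
have xp0 (m : 'I_d) : 0 <= x * p`_m by rewrite mulr_ge0.
have [/existsP[m mj]|/existsPn mj] := boolP [exists m, (mu m == j :> nat)].
- have [t tm] : exists t : 'I_d, t != m.
    have d0 : (0 < d)%N by exact: ltnW.
    have [->|m0] := eqVneq m (Ordinal d0).
      by exists (Ordinal hd); rewrite -val_eqE.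
    by exists (Ordinal d0); rewrite eq_sym.
  have t0 : mu t = 0%N :> nat.
    by move: sum_mu; rewrite (bigD1 m) //= (bigD1 t) //= (eqP mj); lia.
  rewrite (bigD1 t) //= [RHS](bigD1 t) //= t0.
  by rewrite gg' ?g0 // !mul0r.
- apply: eq_bigr => m _; apply: gg' => //.
  by rewrite ltn_neqAle mj /=; exact: (ltn_ord (mu m)).
Qed.

(** * The generating function *)

(** Dominated convergence for a(X) truncated to the event X < J. *)
Lemma cvg_expectation_nat (R : realType) (dT : measure_display)
    (T : measurableType dT) (P : probability T R) (X : {RV P >-> nat})
    (a : nat -> R) : (forall j, `|a j| <= 1) ->
  series (fun j => a j * fine (P (X @^-1` [set j]))) @ \oo -->
  fine ('E_P[fun w => a (X w)])%E.
Proof.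
move=> a1.
have mX j : measurable (X @^-1` [set j]) by exact: measurable_funPTI.
pose f_ J w : \bar R :=
  (\sum_(j < J) (a j)%:E * (\1_(X @^-1` [set val j]) w)%:E)%E.
have int_atom (A : set T) (r : R) : measurable A ->
    P.-integrable setT (fun w => (r%:E * (\1_A w)%:E)%E).
  by move=> mA; apply: integrableZl => //; exact: integrable_indic.
have f_E J w : f_ J w = (series (fun j => (j == X w)%:R * a j) J)%:E.
  rewrite /f_ /series /= big_mkord -sumEFin; apply: eq_bigr => j _.
  rewrite -EFinM mulrC indicE; congr (_%:R * _)%:E; congr nat_of_bool.
  by apply/idP/eqP; rewrite inE /preimage /= => ->.
have [] := @dominated_convergence _ T R P setT measurableT f_
  (fun w => (a (X w))%:E) (cst 1%E).
- move=> J; apply: emeasurable_sum => j.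
  exact: measurable_int (int_atom _ _ (mX j)).
- move=> _ Y mY; rewrite setTI.
  exact: (measurable_funPTI X (Y := [set j | Y (a j)%:E])).
- apply: aeW => w _; under eq_fun do rewrite f_E.
  by apply: cvg_EFin; [exact: nearW|exact: cvg_series_pointmass].
- exact: finite_measure_integrable_cst.
- apply: aeW => w J _; rewrite f_E lee_fin /series /= big_mkord.
  have [XJ|JX] := ltnP (X w) J; first by rewrite (sum_pointmass a XJ).
  rewrite big1 ?normr0 // => j _.
  by rewrite (ltn_eqF (leq_trans (ltn_ord j) JX)) mul0r.
move=> int_f _.
rewrite unlock -[X in _ --> X]fineK; last exact: integrable_fin_num.
move=> /fine_cvgP[_]; apply: cvg_trans; apply: near_eq_cvg; apply: nearW => J.
rewrite /= integral_sum //; last by move=> j; exact: int_atom.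
rewrite /series /= big_mkord -[RHS]/(fine (_%:E)) -sumEFin; congr fine.
apply: eq_bigr => j _.
rewrite integralZl //; last exact: integrable_indic.
rewrite integral_indic // setIT EFinM fineK //.
by rewrite fin_num_measure.
Qed.

Lemma sum_law_le1 (R : realType) (dT : measure_display) (T : measurableType dT)
    (P : probability T R) (l : nat -> {RV P >-> nat}) (n J : nat) :
  \sum_(j < J) law l n j <= 1.
Proof.
rewrite -lee_fin -sumEFin; under eq_bigr do rewrite -lawE.
have mX e : measurable (l n @^-1` [set e]) by exact: measurable_funPTI.
rewrite (eq_bigl (fun j : 'I_J => (val j < J)%N)); last first.
  by move=> j; rewrite ltn_ord.
rewrite -(@probability_finite_atoms _ _ _ P _ _ _ (l n) (fun e => e < J)%N
  val_inj mX).
  by apply: probability_le1; exact: measurable_funPTI.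
by move=> e eJ _; exists (Ordinal eJ).
Qed.

(** Exchange of the sums over n and j: after truncating the sum over j at J,
    the terms in n are dominated by the Poisson weights. *)
Lemma cvg_sum_sicta_q (R : realType) (dT : measure_display)
    (T : measurableType dT) (P : probability T R) (l : nat -> {RV P >-> nat})
    (a : nat -> R) (x : R) : 0 <= x -> (forall j, `|a j| <= 1) ->
  exists S : R,
    series (fun n => x ^+ n / n`!%:R * fine ('E_P[fun w => a (l n w)])%E)
      @ \oo --> S /\
    series (fun j => a j * sicta_q l j x) @ \oo --> expR (- x) * S.
Proof.
move=> x0 a1.
pose E n : R := fine ('E_P[fun w => a (l n w)])%E.
pose u J n : R := poisson_weight x n * \sum_(j < J) a j * law l n j.
pose v n : R := poisson_weight x n * E n.
have uw J n : `|u J n| <= poisson_weight x n.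
  rewrite normrM ger0_norm ?poisson_weight_ge0 // -[leRHS]mulr1.
  rewrite ler_wpM2l ?poisson_weight_ge0 //.
  apply: le_trans (ler_norm_sum _ _ _) _; apply: le_trans (sum_law_le1 l n J).
  apply: ler_sum => j _; rewrite normrM (ger0_norm (law_ge0 _ _ _)).
  by rewrite -[leRHS]mul1r ler_wpM2r ?law_ge0.
have uv n : u ^~ n @ \oo --> v n.
  apply: cvgM; first exact: cvg_cst.
  have := @cvg_expectation_nat _ _ _ P (l n) a a1; apply: cvg_trans.
  by apply: near_eq_cvg; apply: nearW => J; rewrite /series /= big_mkord.
have cw : cvgn (series (poisson_weight x)).
  by apply/cvg_ex; exists 1; exact: cvg_poisson_weight.
have [cv lim_uv] := tannery uw uv cw.
have vE n : x ^+ n / n`!%:R * E n = expR x * v n.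
  by rewrite /v /poisson_weight !mulrA expRxMexpNx_1 mul1r.
exists (expR x * limn (series v)); split.
  have -> : series (fun n => x ^+ n / n`!%:R * E n) =
      (fun N => expR x * series v N).
    apply/funext => N; rewrite /series /= mulr_sumr.
    by apply: eq_bigr => n _; exact: vE.
  by apply: cvgM; [exact: cvg_cst|exact: cv].
rewrite mulrA [expR (- x) * _]mulrC expRxMexpNx_1 mul1r.
move: lim_uv; apply: cvg_trans; apply: near_eq_cvg; apply: nearW => J.
apply: (cvg_lim (@Rhausdorff R)).
have -> : series (u J) =
    (fun N => \sum_(j < J)
       a j * series (fun n => law l n j * poisson_weight x n) N).
  apply/funext => N; rewrite /series /=.
  under [RHS]eq_bigr do rewrite mulr_sumr.
  rewrite exchange_big /=; apply: eq_bigr => n _; rewrite /u mulr_sumr.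
  by apply: eq_bigr => j _; ring.
rewrite /series /= big_mkord; apply: cvg_sum_fin => j _.
by apply: cvgM; [exact: cvg_cst|exact: cvg_sicta_q].
Qed.

Lemma cvg_complex (R : realType) (u v : nat -> R) (a b : R) :
  u @ \oo --> a -> v @ \oo --> b ->
  (fun n => (u n +i* v n : R[i]^o)) @ \oo --> (a +i* b : R[i]^o).
Proof.
move=> ua vb; apply/cvgrPdist_lt => -[e e'] /=.
rewrite ltcE /= => /andP[/eqP -> e0].
have e2 : 0 < e / 2 by rewrite divr_gt0.
near=> n.
have un : `|a - u n| < e / 2 by near: n; move/cvgrPdist_lt : ua; exact.
have vn : `|b - v n| < e / 2 by near: n; move/cvgrPdist_lt : vb; exact.
have -> : (e +i* 0 : R[i]) = e%:C by [].
rewrite normc_def ltcR /=.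
apply: (@le_lt_trans _ _ (`|a - u n| + `|b - v n|)).
  rewrite -[leRHS]ger0_norm ?addr_ge0 // -sqrtr_sqr ler_wsqrtr //.
  rewrite [leRHS]sqrrD !real_normK ?num_real //.
  by rewrite -addrA [X in _ <= _ + X]addrC addrA lerDl mulrn_wge0 // mulr_ge0.
by rewrite [ltRHS](splitr e) ltrD.
Unshelve. all: by end_near. Qed.

Lemma sum_complexE (R : realType) (f g : nat -> R) (N : nat) :
  \sum_(0 <= n < N) (f n +i* g n) =
  (\sum_(0 <= n < N) f n) +i* (\sum_(0 <= n < N) g n) :> R[i].
Proof.
elim: N => [|N IH]; first by rewrite !big_geq.
by rewrite !big_nat_recr //= IH.
Qed.

Lemma mulr_complexE (R : realType) (z : R[i]) (r : R) :
  z * r%:C = (complex.Re z * r) +i* (complex.Im z * r).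
Proof. by case: z => a b; simpc. Qed.

Lemma normr_Re_le1 (R : realType) (z : R[i]) :
  `|z| <= 1 -> `|complex.Re z| <= 1.
Proof. by move=> z1; rewrite -lecR; exact: le_trans (normc_ge_Re z) z1. Qed.

Lemma normr_Im_le1 (R : realType) (z : R[i]) :
  `|z| <= 1 -> `|complex.Im z| <= 1.
Proof.
move=> z1; rewrite -lecR; apply: le_trans z1; case: z => a b; rewrite normc_def.
by rewrite lecR /= -sqrtr_sqr ler_wsqrtr // lerDr sqr_ge0.
Qed.

Lemma cvg_sicta_Q (R : realType) (dT : measure_display)
    (T : measurableType dT) (P : probability T R) (l : nat -> {RV P >-> nat})
    (x : R) (z : R[i]) : 0 <= x -> `|z| <= 1 ->
  series ((fun j : nat => z ^+ j * (sicta_q l j x)%:C) : nat -> R[i]^o)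
    @ \oo --> sicta_Q l x z.
Proof.
move=> x0 z1.
have zj1 j : `|z ^+ j| <= 1 by rewrite normrX exprn_ile1.
have [A [cvgA qA]] := cvg_sum_sicta_q l x0 (fun j => normr_Re_le1 (zj1 j)).
have [B [cvgB qB]] := cvg_sum_sicta_q l x0 (fun j => normr_Im_le1 (zj1 j)).
have -> : sicta_Q l x z = (expR (- x) * A) +i* (expR (- x) * B).
  rewrite /sicta_Q; transitivity ((expR (- x))%:C * (A +i* B)); last by simpc.
  congr (_ * _); apply: cvg_lim; first exact: norm_hausdorff.
  have := cvg_complex cvgA cvgB; apply: cvg_trans; apply: near_eq_cvg.
  apply: nearW => N; rewrite /series /= -sum_complexE; apply: eq_bigr => n _.
  by rewrite /complex_expectation; simpc.
have := cvg_complex qA qB; apply: cvg_trans; apply: near_eq_cvg.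
apply: nearW => N; rewrite /series /= -sum_complexE; apply: eq_bigr => n _.
by rewrite mulr_complexE.
Qed.

Theorem proposition3 (R : realType) (d : nat) (hd : (2 <= d)%N)
    (p : d.-tuple R) (p_ge0 : forall i : 'I_d, 0 <= p`_i)
    (p_sum1 : \sum_(i < d) p`_i = 1) (p_neq1 : forall i : 'I_d, p`_i != 1)
    (dT : measure_display) (T : measurableType dT) (P : probability T R)
    (l : nat -> {RV P >-> nat}) (hl : is_sicta p l) :
  [/\ forall (x : R) (z : R[i]), 0 <= x -> `|z| <= 1 ->
        series ((fun j : nat => z ^+ j * (sicta_q l j x)%:C) : nat -> R[i]^o)
          @ \oo --> sicta_Q l x z,
      forall x : R, 0 <= x -> sicta_q l 0%N x = 0,
      forall (j : nat) (x : R), (1 <= j)%N -> 0 <= x ->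
        sicta_q l j x = recursion_rhs p (sicta_q l) j x
    & (* the right-hand side depends only on q_0, ..., q_(j-1) *)
      forall (j : nat) (g : nat -> R -> R), (1 <= j)%N ->
        (forall (i : nat) (y : R), (i < j)%N -> 0 <= y ->
           g i y = sicta_q l i y) ->
        forall x : R, 0 <= x ->
          recursion_rhs p g j x = recursion_rhs p (sicta_q l) j x].
Proof.
have q0 (x : R) : 0 <= x -> sicta_q l 0%N x = 0.
  move=> x0; rewrite -(cvg_lim (@Rhausdorff R) (@cvg_sicta_q _ _ _ _ l 0 _ x0)).
  apply: (cvg_lim (@Rhausdorff R)); apply: cvg_near_cst; apply: nearW => N.
  by rewrite /series /= big1 // => n _; rewrite (law_at0 _ hd hl) mul0r.
split=> //.
- by move=> x z; exact: cvg_sicta_Q.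
- by move=> j x; apply: sicta_q_recursion => //; exact: ltnW.
- move=> j g j1 gq x x0; rewrite /recursion_rhs.
  congr (_ + _); first exact: Qconv_eq_full.
  apply: eq_bigr => k _.
  have kd : (k <= d)%N by apply: leq_trans (ltnW (ltn_ord k)) (leq_pred d).
  by congr (_ * (_ * _ - _ * _));
    apply: (@Qconv_eq_below _ _ _ _ _ _ _ j) => //; lia.
Qed.
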